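(* Every polyhedral (real) Banach space with the approximation property has property B$^k$.
   Context: A real Banach space is polyhedral if the unit balls of all of its finite-dimensional subspaces are polyhedra, i.e. convex hulls of finitely many points. For Banach spaces $X,Y$, $K(X,Y)$ is the space of compact linear operators from $X$ into $Y$ with the operator norm, and $NA(X,Y)$ is the set of bounded linear operators $T:X\to Y$ attaining their norm, i.e. such that $\|T\|=\|Tx\|$ for some $x\in X$ with $\|x\|=1$. A Banach space $Y$ has property B$^k$ if $K(X,Y)\cap NA(X,Y)$ is dense in $K(X,Y)$ for every Banach space $X$. A Banach space $Y$ has the approximation property if for every compact set $C\subset Y$ and every $\varepsilon>0$ there is a finite-rank bounded linear operator $R:Y\to Y$ with $\|y-R(y)\|<\varepsilon$ for all $y\in C$. *)

(* Defs.v *)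
From HB Require Import structures.
From mathcomp Require Import all_boot all_order all_algebra.
From mathcomp Require Import all_classical all_reals all_analysis.

Set Implicit Arguments.
Unset Strict Implicit.
Unset Printing Implicit Defensive.

Import Order.TTheory GRing.Theory Num.Theory.
Import numFieldNormedType.Exports.

Local Open Scope classical_set_scope.
Local Open Scope ring_scope.

Definition unit_ball (R : realType) (X : normedModType R) : set X :=
  [set x | `|x| <= 1].
Arguments unit_ball {R} X.

Definition lin_span (R : realType) (X : lmodType R) (n : nat)
    (e : 'I_n -> X) : set X :=
  [set \sum_(i < n) a i *: e i | a in [set: 'I_n -> R]].

Definition finite_dim_subspace (R : realType) (X : lmodType R) (E : set X) :=
  exists (n : nat) (e : 'I_n -> X), E = lin_span e.

Definition convex_hull (R : realType) (X : lmodType R) (A : set X) : set X :=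
  smallest (@convex_set R X) A.

Definition polyhedron (R : realType) (X : lmodType R) (P : set X) :=
  exists2 A : set X, finite_set A & P = convex_hull A.

Definition polyhedral (R : realType) (Y : normedModType R) :=
  forall E : set Y, finite_dim_subspace E -> polyhedron (E `&` unit_ball Y).

Definition bounded_operator (R : realType) (X Y : normedModType R)
    (T : {linear X -> Y}) :=
  [bounded T x | x in unit_ball X].

(* [sup] is only meaningful here when [T] is bounded on the unit ball. *)
Definition op_norm (R : realType) (X Y : normedModType R) (T : X -> Y) : R :=
  sup [set `|T x| | x in unit_ball X].

Definition compact_operators (R : realType) (X Y : normedModType R) :
    set {linear X -> Y} :=
  [set T | precompact (T @` unit_ball X)].
Arguments compact_operators {R} X Y.

Definition norm_attaining (R : realType) (X Y : normedModType R) :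
    set {linear X -> Y} :=
  [set T | bounded_operator T /\
           exists x : X, `|x| = 1 /\ op_norm T = `|T x|].
Arguments norm_attaining {R} X Y.

(* The domain [X] ranges over nonzero spaces: the zero space has no vector of
   norm 1, hence no norm-attaining operator at all. *)
Definition property_Bk (R : realType) (Y : completeNormedModType R) :=
  forall X : completeNormedModType R, (exists x : X, x != 0) ->
  forall T : {linear X -> Y}, compact_operators X Y T ->
  forall eps : R, 0 < eps ->
  exists S : {linear X -> Y},
    (compact_operators X Y `&` norm_attaining X Y) S /\
    op_norm (T \- S) < eps.

Definition finite_rank (R : realType) (X Y : normedModType R)
    (T : {linear X -> Y}) :=
  finite_dim_subspace (range T).

Definition approximation_property (R : realType) (Y : normedModType R) :=
  forall C : set Y, compact C ->
  forall eps : R, 0 < eps ->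
  exists F : {linear Y -> Y},
    [/\ bounded_operator F, finite_rank F &
        forall y, C y -> `|y - F y| < eps].

(* Main.v *)
(** By the approximation property a compact operator is approximated by a finite-rank
    one [S], whose range [E] has a polyhedral unit ball. The norm of [E] is then the
    maximum of finitely many functionals [|f i|], and a minimal such family satisfies
    Lindenstrauss' property beta: each [f i] equals 1 at a unit vector [u i] where
    all the others stay below some [rho < 1] in absolute value. Choose [i] such that
    [f i o S] has almost the norm of [S], replace [f i o S] by a nearby norm-attaining
    functional [g] (Bishop-Phelps), and move [S] in the direction [u i] so that the
    new operator [S'] satisfies [f i o S' = (1 + eta) g]: its norm is that of
    [(1 + eta) g], hence attained. *)

Require Import Defs.
From HB Require Import structures.
From mathcomp Require Import all_boot all_order all_algebra.
From mathcomp Require Import all_classical all_reals all_analysis.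
From mathcomp Require Import ring lra.

Set Implicit Arguments.
Unset Strict Implicit.
Unset Printing Implicit Defensive.

Import Order.TTheory GRing.Theory Num.Theory.
Import numFieldNormedType.Exports.

Local Open Scope classical_set_scope.
Local Open Scope ring_scope.

(** * Sublinear functionals and the Hahn-Banach theorem *)

Definition sublinear (R : realType) (V : lmodType R) (p : V -> R) :=
  (forall x y, p (x + y) <= p x + p y) /\
  (forall t x, 0 <= t -> p (t *: x) <= t * p x).

Section hahn_banach.
Context {R : realType} {V : lmodType R}.
Implicit Types p q : V -> R.

Lemma sublinear0 p : sublinear p -> p 0 = 0.
Proof.
move=> [pD pZ]; have := pZ 0 0 (lexx _); rewrite scale0r mul0r => p0.
have := pD 0 0; rewrite addr0 => p1.
by apply/eqP; rewrite eq_le p0/=; lra.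
Qed.

Lemma sublinearN_ge p x : sublinear p -> - p (- x) <= p x.
Proof. by move=> ps; have := ps.1 x (- x); rewrite subrr sublinear0//; lra. Qed.

(** A pair [(y, c)] stands for the constraint [c <= f y] on a linear functional [f]; such
    constraints can be added and scaled by [t >= 0]. *)
Definition cone (G : set (V * R)) := [/\ G (0, 0),
  (forall u v, G u -> G v -> G (u.1 + v.1, u.2 + v.2)) &
  (forall t u, 0 <= t -> G u -> G (t *: u.1, t * u.2))].

Lemma cone_ray (y : V) (c : R) :
  cone [set (t *: y, t * c) | t in [set t : R | 0 <= t]].
Proof.
split=> [|_ _ [s /= s0 <-] [t /= t0 <-]|s _ s0 [t /= t0 <-]].
- by exists 0; rewrite /= ?scale0r ?mul0r.
- by exists (s + t); rewrite /= ?addr_ge0// scalerDl mulrDl.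
- by exists (s * t); rewrite /= ?mulr_ge0// scalerA mulrA.
Qed.

(* When [u.2 <= p u.1] on [G], every linear functional below [inf_conv p G] is below [p]
   and satisfies [u.2 <= f u.1] on [G]. *)
Definition inf_conv p (G : set (V * R)) (x : V) : R :=
  inf [set p (x + u.1) - u.2 | u in G].

Section inf_conv_theory.
Variables (p : V -> R) (G : set (V * R)).
Hypotheses (ps : sublinear p) (Gc : cone G).
Hypothesis Gp : forall u, G u -> u.2 <= p u.1.

Lemma inf_conv_le u x : G u -> inf_conv p G x <= p (x + u.1) - u.2.
Proof.
move=> Gu; apply: ge_inf; last by exists u.
(* A lower bound for the infimum: [v.2 <= p v.1 <= p (- x) + p (x + v.1)] for [v] in [G]. *)
exists (- p (- x)) => _ [v Gv <-]; have := ps.1 (- x) (x + v.1).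
by rewrite addKr => h; have := Gp Gv; lra.
Qed.

Lemma le_inf_conv c x : (forall u, G u -> c <= p (x + u.1) - u.2) ->
  c <= inf_conv p G x.
Proof.
move=> h; apply: lb_le_inf; first by exists (p (x + 0) - 0), (0, 0) => //; case: Gc.
by move=> _ [u Gu <-]; exact: h.
Qed.

Lemma inf_conv_le_self x : inf_conv p G x <= p x.
Proof.
by have := @inf_conv_le (0, 0) x; rewrite addr0 subr0; apply; case: Gc.
Qed.

Lemma sublinear_inf_conv : sublinear (inf_conv p G).
Proof.
case: Gc => G0 GD GZ; split=> [x y|t x t0].
  rewrite -lerBlDr; apply: le_inf_conv => u Gu.
  rewrite lerBlDr -lerBlDl; apply: le_inf_conv => v Gv.
  have := inf_conv_le (x + y) (GD _ _ Gu Gv).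
  have := ps.1 (x + u.1) (y + v.1).
  by rewrite addrACA/=; lra.
have [->|tn0] := eqVneq t 0.
  rewrite scale0r mul0r; apply: le_trans (inf_conv_le_self _) _.
  by rewrite sublinear0.
have tgt0 : 0 < t by rewrite lt_def tn0.
rewrite mulrC -ler_pdivrMr//; apply: le_inf_conv => u Gu.
rewrite ler_pdivrMr// mulrC mulrBr.
have := inf_conv_le (t *: x) (GZ t _ t0 Gu).
have := ps.2 t (x + u.1) t0.
by rewrite scalerDr/=; lra.
Qed.

End inf_conv_theory.

(* The infimal convolution of [p] with the ray through [(y, p y)] lies below [p];
   equality there says [p x + p y <= p (x + y)]. *)
Lemma minimal_sublinear_additive p : sublinear p ->
  (forall q, sublinear q -> (forall x, q x <= p x) -> q = p) ->
  forall x y, p (x + y) = p x + p y.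
Proof.
move=> ps pmin x y; apply/eqP; rewrite eq_le ps.1/=.
pose G : set (V * R) := [set (t *: y, t * p y) | t in [set t : R | 0 <= t]].
have Gc : cone G by exact: cone_ray.
have Gp u : G u -> u.2 <= p u.1.
  move=> [t /= t0 <-]/=.
  have [->|tn0] := eqVneq t 0; first by rewrite scale0r mul0r sublinear0.
  have tgt0 : 0 < t by rewrite lt_def tn0.
  have := ps.2 t^-1 (t *: y); rewrite invr_ge0 => /(_ t0).
  by rewrite scalerK// mulrC ler_pdivlMr// mulrC.
have <- := pmin _ (sublinear_inf_conv ps Gc Gp) (inf_conv_le_self ps Gc Gp).
have := @inf_conv_le _ _ ps Gp (y, p y) x.
rewrite lerBrDr (pmin _ (sublinear_inf_conv ps Gc Gp)) //; last first.
  exact: (inf_conv_le_self ps Gc Gp).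
by apply; exists 1; rewrite /= ?scale1r ?mul1r.
Qed.

(** Zorn's lemma for the reversed pointwise order: a nonempty chain is bounded by its pointwise
    infimum, which is finite because a sublinear [r <= p] satisfies [- p (- x) <= r x]. *)
Lemma minimal_sublinear p : sublinear p ->
  exists q, [/\ sublinear q, forall x, q x <= p x &
    forall r, sublinear r -> (forall x, r x <= q x) -> r = q].
Proof.
move=> ps.
pose T := {q : V -> R | sublinear q /\ forall x, q x <= p x}.
pose Rel (q r : T) := `[< forall x, sval r x <= sval q x >].
have [||||[q [qs qp]] qmin] := @Zorn T Rel.
- by move=> q; apply/asboolP.
- move=> q r s /asboolP qr /asboolP rs; apply/asboolP => x.
  exact: le_trans (rs x) (qr x).
- move=> [q qP] [r rP] /asboolP/= qr /asboolP/= rq; apply: eq_exist.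
  by apply/funext => x; apply/eqP; rewrite eq_le qr rq.
- move=> A Atot.
  have [->|/set0P[q0 Aq0]] := eqVneq A set0.
    by exists (exist _ p (conj ps (fun x => lexx (p x)))).
  pose m x := inf [set sval z x | z in A].
  have m_le (q : T) x : A q -> m x <= sval q x.
    move=> Aq; apply: ge_inf; last by exists q.
    exists (- p (- x)) => _ [[r [rs rp]] _ <-]/=.
    by have := sublinearN_ge x rs; have := rp (- x); lra.
  have m_ge c x : (forall q : T, A q -> c <= sval q x) -> c <= m x.
    move=> h; apply: lb_le_inf; first by exists (sval q0 x), q0.
    by move=> _ [q Aq <-]; exact: h.
  have ms : sublinear m.
    split=> [x y|t x t0].
      rewrite -lerBlDr; apply: (m_ge) => q Aq; rewrite lerBlDr -lerBlDl.
      apply: m_ge => r Ar; rewrite lerBlDl.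
      have [/asboolP qr|/asboolP rq] := Atot q r Aq Ar.
        apply: le_trans (m_le r _ Ar) (le_trans ((svalP r).1.1 _ _) _).
        by rewrite lerD2r.
      apply: le_trans (m_le q _ Aq) (le_trans ((svalP q).1.1 _ _) _).
      by rewrite lerD2l.
    have [->|tn0] := eqVneq t 0.
      rewrite scale0r mul0r; apply: le_trans (m_le _ _ Aq0) _.
      by rewrite sublinear0//; case: (svalP q0).
    have tgt0 : 0 < t by rewrite lt_def tn0.
    rewrite mulrC -ler_pdivrMr//; apply: (m_ge) => q Aq.
    rewrite ler_pdivrMr// mulrC; apply: le_trans (m_le q _ Aq) _.
    exact: (svalP q).1.2.
  have mp x : m x <= p x by apply: le_trans (m_le q0 _ Aq0) ((svalP q0).2 x).
  by exists (exist _ m (conj ms mp)) => q Aq; apply/asboolP => x; exact: m_le.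
exists q; split=> // r rs rq.
have rp x : r x <= p x by apply: le_trans (rq x) (qp x).
by have /(_ _)/(congr1 sval) := qmin (exist _ r (conj rs rp)); apply; apply/asboolP.
Qed.

(** A minimal sublinear functional below [p] is additive, hence odd, and oddness extends homogeneity
    to negative scalars. *)
Theorem hahn_banach p : sublinear p ->
  exists f : {scalar V}, forall x, f x <= p x.
Proof.
move=> /minimal_sublinear[q [qs qp qmin]].
have qD := minimal_sublinear_additive qs qmin.
have qN x : q (- x) = - q x.
  by have := qD x (- x); rewrite subrr sublinear0//; lra.
have qZ0 t x : 0 <= t -> q (t *: x) = t * q x.
  move=> t0; apply/eqP; rewrite eq_le qs.2//= -lerN2 -qN -mulrN -qN -scalerN.
  exact: qs.2.
have qlin : scalar q.
  move=> t x y; rewrite qD; congr (_ + _).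
  have [t0|/ltW t0] := leP 0 t; first exact: qZ0.
  by rewrite -(opprK (t *: x)) -scaleNr qN qZ0 ?oppr_ge0// mulNr opprK.
pose qL := GRing.isLinear.Build R V R *%R q qlin.
pose f : {scalar V} := HB.pack q qL.
by exists f => x; exact: qp.
Qed.

Corollary hahn_banach_cone p (G : set (V * R)) : sublinear p -> cone G ->
  (forall u, G u -> u.2 <= p u.1) ->
  exists f : {scalar V}, (forall x, f x <= p x) /\ (forall u, G u -> u.2 <= f u.1).
Proof.
move=> ps Gc Gp; have [f fle] := hahn_banach (sublinear_inf_conv ps Gc Gp).
exists f; split=> [x|u Gu].
  by apply: le_trans (fle x) _; exact: inf_conv_le_self.
have := le_trans (fle (- u.1)) (inf_conv_le ps Gp (- u.1) Gu).
by rewrite addNr sublinear0// sub0r linearN lerN2.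
Qed.

End hahn_banach.

(** * Ekeland's variational principle and the Bishop-Phelps theorem *)

(* Each point of the sequence built below at least halves the gain [s x - f x] still
   available to its successors, so the sequence is Cauchy, and its limit has no
   successor but itself. *)
Lemma ekeland (R : realType) (X : completeNormedModType R) (B : set X)
    (f : X -> R) (e M : R) :
  0 < e -> closed B -> B !=set0 -> continuous f -> (forall x, B x -> f x <= M) ->
  exists2 x, B x & forall z, B z -> f z - f x <= e * `|z - x|.
Proof.
move=> e0 Bcl [b0 Bb0] fc fM.
(* The successors of [x]: points of [B] whose gain in [f] is at least [e] times their distance from
   [x]. *)
pose U x : set X := [set z | B z /\ e * `|z - x| <= f z - f x].
have U_refl x : B x -> U x x by move=> Bx; split=> //; rewrite !subrr normr0 mulr0.
have U_trans x y z : U x y -> U y z -> U x z.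
  move=> [_ xy] [Bz yz]; split=> //.
  have := ler_distD y z x; rewrite -(ler_pM2l e0) mulrDr; lra.
pose s x := sup (f @` U x).
have U_sup x : B x -> has_sup (f @` U x).
  move=> Bx; split; first by exists (f x), x => //; exact: U_refl.
  by exists M => _ [z [Bz _] <-]; exact: fM.
have f_le_s x z : B x -> U x z -> f z <= s x.
  by move=> Bx Uz; apply: sup_upper_bound; [exact: U_sup|exists z].
have next x : exists y, B x -> U x y /\ (f x + s x) / 2 <= f y.
  have [Bx|] := pselect (B x); last by exists x.
  have [fs|fs] := leP (s x) (f x).
    by exists x => _; split; [exact: U_refl|lra].
  have d0 : 0 < (s x - f x) / 2 by lra.
  have [_ [y Uy <-]] := sup_adherent d0 (U_sup _ Bx).
  by rewrite -/(s x) => h; exists y => _; split=> //; lra.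
have /choice[nx nxP] := next.
pose u n := iter n nx b0.
have Bu n : B (u n).
  by elim: n => // n Bn; rewrite /u iterS; have [[]] := nxP _ Bn.
have Uu n m : (n <= m)%N -> U (u n) (u m).
  move=> /subnK <-; elim: (m - n)%N => [|k IH]; first exact: U_refl.
  by apply: U_trans IH _; rewrite addSn /u iterS; have [] := nxP _ (Bu (k + n)%N).
(* [s (u n) - f (u n)] bounds the gain left after [u n], and at least halves at each step since [s]
   does not increase along [u]. *)
have gap n z : U (u n) z -> e * `|z - u n| <= geometric (s b0 - f b0) 2^-1 n.
  move=> Unz; apply: le_trans Unz.2 _.
  apply: (@le_trans _ _ (s (u n) - f (u n))); first by rewrite lerB// f_le_s.
  elim: n {z Unz} => [|n IH]; first by rewrite /geometric/= expr0 mulr1.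
  rewrite /geometric/= exprSr mulrA.
  have [Un1 h] := nxP _ (Bu n).
  have : s (u n.+1) <= s (u n).
    apply: ge_sup; first by have [] := U_sup _ (Bu n.+1).
    by move=> _ [z Uz <-]; apply: f_le_s => //; exact: U_trans Un1 Uz.
  by move: IH h; rewrite /geometric/=; lra.
have geo0 : geometric (s b0 - f b0) 2^-1 @ \oo --> (0 : R).
  by apply: cvg_geometric; rewrite ger0_norm ?invr_ge0// invf_lt1// ltr1n.
have geo_small d : 0 < d -> exists n, geometric (s b0 - f b0) 2^-1 n < e * d.
  move=> d0.
  have : \forall n \near \oo, geometric (s b0 - f b0) 2^-1 n < e * d.
    by apply: (cvgr_lt (0 : R)) => //; rewrite mulr_gt0.
  by move=> [n _ /(_ n (leqnn n))]; exists n.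
have u_cvg : cvg (u @ \oo).
  apply/cauchy_cvgP/cauchy_exP => d d0; have [n ngeo] := geo_small d d0.
  exists (u n), n => // m /= nm; rewrite -ball_normE/= distrC.
  by have := gap _ _ (Uu _ _ nm); rewrite -(ltr_pM2l e0) => /le_lt_trans; apply.
pose l := lim (u @ \oo).
have Bl : B l by apply: (@closed_cvg _ _ \oo _ u B Bcl _ l u_cvg); exact: nearW.
have Ul n : U (u n) l.
  split=> //.
  have cl : closed [set z | e * `|z - u n| - (f z - f (u n)) <= 0].
    have := @preimage_closed _ _ (fun z => e * `|z - u n| - (f z - f (u n))) [set x | x <= 0].
    apply; last exact: closed_le.
    move=> z _; apply: cvgB.
      apply: cvgM; first exact: cvg_cst.
      by apply: cvg_norm; apply: cvgB; [exact: cvg_id|exact: cvg_cst].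
    by apply: cvgB; [exact: fc|exact: cvg_cst].
  rewrite -subr_le0; apply: (@closed_cvg _ _ \oo _ u _ cl _ l u_cvg).
  by exists n => // m /= nm; rewrite subr_le0; have [] := Uu _ _ nm.
(* A [z] violating the inequality succeeds [l], hence every [u n], and [gap] then forces [z = l]. *)
exists l => // z Bz; rewrite leNgt; apply/negP => zl.
have Uz n : U (u n) z by apply: U_trans (Ul n) _; split=> //; exact: ltW.
have : `|z - l| <= 0.
  apply/ler_addgt0Pl => d d0; rewrite addr0.
  have [n] := geo_small (d / 2) ltac:(by rewrite divr_gt0).
  have := gap _ _ (Uz n); have := gap _ _ (Ul n); rewrite (distrC l).
  have := ler_distD (u n) z l.
  by rewrite -(ler_pM2l e0) -[_ <= d](ler_pM2l e0) mulrDr; lra.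
by rewrite normr_le0 subr_eq0 => /eqP zE; move: zl; rewrite zE !subrr normr0 mulr0 ltxx.
Qed.

Lemma bounded_scalar_continuous (R : realType) (X : normedModType R)
    (f : {scalar X}) (M : R) : (forall x, `|f x| <= M * `|x|) -> continuous (f : X -> R).
Proof.
move=> fM x; apply/cvgrPdist_lt => d d0.
have M0 : 0 < `|M| + 1 by rewrite ltr_wpDl.
near=> y; rewrite -linearB; apply: le_lt_trans (fM _) _.
apply: (@le_lt_trans _ _ ((`|M| + 1) * `|x - y|)).
  by apply: ler_wpM2r => //; rewrite (le_trans (ler_norm M))// lerDl.
rewrite -ltr_pdivlMl//; near: y.
by apply: cvgr_dist_lt; [exact: cvg_id|rewrite mulr_gt0// invr_gt0].
Unshelve. all: by end_near. Qed.

(* A linear [h <= e |.|] dominating [f] on the cone spanned by [B - x0] is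
   subtracted from [f]: then [f - h] attains its maximum on [B] at [x0]. *)
Theorem bishop_phelps (R : realType) (X : completeNormedModType R)
    (f : {scalar X}) (e : R) (M : R) : 0 < e -> (forall x, `|f x| <= M * `|x|) ->
  exists (g : {scalar X}) (x0 : X), [/\ `|x0| <= 1,
    forall x, `|x| <= 1 -> g x <= g x0 &
    forall x, `|f x - g x| <= e * `|x|].
Proof.
move=> e0 fM.
have fM1 x : `|x| <= 1 -> f x <= `|M|.
  move=> x1; apply: le_trans (ler_norm _) _; apply: le_trans (fM x) _.
  apply: (@le_trans _ _ (`|M| * `|x|)); first by rewrite ler_wpM2r// ler_norm.
  by rewrite ler_piMr.
have [||x0 /= x01 x0max] := ekeland e0 (_ : closed [set x : X | `|x| <= 1]) _
    (bounded_scalar_continuous fM) fM1.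
- apply: (@preimage_closed _ _ (fun x : X => `|x|) [set r | r <= 1]) => [x _|].
    exact: norm_continuous.
  exact: closed_le.
- by exists 0; rewrite /= normr0.
pose p x := e * `|x : X|.
have ps : sublinear p.
  split=> [x y|t x t0]; first by rewrite /p -mulrDr ler_pM2l// ler_normD.
  by rewrite /p normrZ ger0_norm// mulrCA.
pose G : set (X * R) := [set w : X * R | exists t z,
  [/\ 0 <= t, `|z| <= 1 & w = (t *: (z - x0), t * (f z - f x0))]].
have Gc : cone G.
  split.
  - by exists 0, 0; split=> //; rewrite ?normr0// scale0r mul0r.
  - move=> _ _ [s [y [s0 y1 ->]]] [t [z [t0 z1 ->]]] /=.
    (* When both weights vanish, [x0] serves as the point; otherwise it is the convex combination of
       [y] and [z] with weights [s] and [t] divided by [s + t]. *)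
    have [st0|st0] := eqVneq (s + t) 0.
      have sE : s = 0 by lra.
      have tE : t = 0 by lra.
      exists 0, x0; split=> //.
      by rewrite sE tE !scale0r !mul0r !addr0.
    have st : 0 < s + t by rewrite lt_def st0 addr_ge0.
    exists (s + t), ((s + t)^-1 *: (s *: y + t *: z)); split; first exact: ltW.
      rewrite normrZ ger0_norm ?invr_ge0 ?(ltW st)// ler_pdivrMl// mulr1.
      apply: le_trans (ler_normD _ _) _; rewrite !normrZ !ger0_norm//.
      by apply: lerD; rewrite ler_piMr.
    congr pair; first by rewrite !scalerBr scalerA divff// scale1r scalerDl opprD addrACA.
    by rewrite linearZ/= linearD/= !linearZ/=; field.
  - move=> s _ s0 [t [z [t0 z1 ->]]]; exists (s * t), z.
    by split; rewrite ?mulr_ge0//= scalerA mulrA.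
have Gp w : G w -> w.2 <= p w.1.
  move=> [t [z [t0 z1 ->]]]; rewrite /p/= normrZ ger0_norm// mulrCA.
  by rewrite ler_wpM2l// x0max.
have [h [hp hG]] := hahn_banach_cone ps Gc Gp.
have gP : scalar (fun x => f x - h x).
  by move=> a x y; rewrite (linearP f) (linearP h)/=; ring.
pose g : {scalar X} := HB.pack (fun x => f x - h x)
  (GRing.isLinear.Build R X R *%R (fun x => f x - h x) gP).
exists g, x0; split=> // [x x1|x].
  rewrite /g/=.
  have Gx : G (x - x0, f x - f x0) by exists 1, x; rewrite scale1r mul1r.
  by have := hG _ Gx; rewrite /= linearB/=; lra.
rewrite /g/= subKr ler_norml hp andbT lerNl -linearN.
by have := hp (- x); rewrite /p normrN.
Qed.

(** * Compact convex sets containing a finite set *)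

Section convex_hull_of_finite_set.
Context {R : realType}.

Lemma convex_setP (V : lmodType R) (A : set V) :
  (forall t x y, 0 <= t -> t <= 1 -> A x -> A y -> A (t *: x + (1 - t) *: y)) ->
  @convex_set R V A.
Proof.
by move=> h x y t; rewrite !inE => Ax Ay; exact: h.
Qed.

Lemma convex_hull_sub (V : lmodType R) (A B : set V) : A `<=` B ->
  (forall t x y, 0 <= t -> t <= 1 -> B x -> B y -> B (t *: x + (1 - t) *: y)) ->
  convex_hull A `<=` B.
Proof. by move=> AB /convex_setP Bc; apply: smallest_sub. Qed.

(** Instead of the hull, the sum of the segments from 0 to the points of [s]: adding a segment
    preserves compactness and convexity, and 0 in each summand keeps all the points. *)
Lemma compact_convex_superset (Y : normedModType R) (s : seq Y) :
  exists K : set Y, [/\ compact K, [set` s] `<=` K, K 0 &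
    forall t x y, 0 <= t -> t <= 1 -> K x -> K y -> K (t *: x + (1 - t) *: y)].
Proof.
elim: s => [|a s [K [Kc sK K0 Kconv]]].
  exists [set 0]; split=> //; first exact: compact_set1.
  by move=> t _ _ _ _ -> ->; rewrite !scaler0 addr0.
exists [set u.1 *: a + u.2 | u in `[0, 1] `*` K]; split.
- apply: continuous_compact; last exact: compact_setX (@segment_compact _ _ _) Kc.
  apply: continuous_subspaceT => u; apply: cvgD; last exact: cvg_snd.
  by apply: cvgZr_tmp; exact: cvg_fst.
- move=> x; rewrite /= inE => /orP[/eqP ->|xs].
    by exists (1, 0); rewrite /= ?scale1r ?addr0// in_itv/= ler01 lexx.
  exists (0, x); rewrite /= ?scale0r ?add0r// in_itv/= ler01 lexx.
  by split=> //; exact: sK.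
- by exists (0, 0); rewrite /= ?scale0r ?add0r// in_itv/= ler01 lexx.
- move=> t _ _ t0 t1 [[r x] [/= + Kx] <-] [[q y] [/= + Ky] <-].
  rewrite !in_itv/= => /andP[r0 r1] /andP[q0 q1].
  exists (t * r + (1 - t) * q, t *: x + (1 - t) *: y).
    split; last exact: Kconv.
    rewrite /= in_itv/=; apply/andP; split.
      by rewrite addr_ge0// mulr_ge0// subr_ge0.
    have : t * r <= t by rewrite ler_piMr.
    have : (1 - t) * q <= 1 - t by rewrite ler_piMr// subr_ge0.
    lra.
  by rewrite /= (scalerDl a) !scalerDr !scalerA addrACA.
Qed.

End convex_hull_of_finite_set.

(** * Norming functionals of a polyhedral unit ball *)

Lemma normr_normalize (R : realType) (Y : normedModType R) (y : Y) :
  y != 0 -> `| `|y|^-1 *: y | = 1.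
Proof. by move=> y0; rewrite normrZ normfV normr_id mulVf// normr_eq0. Qed.

(** Hahn-Banach for the norm, with the constraint [|y| <= f y]. *)
Lemma norming_scalar (R : realType) (Y : normedModType R) (y : Y) :
  exists f : {scalar Y}, (forall x, `|f x| <= `|x|) /\ f y = `|y|.
Proof.
pose p (x : Y) := `|x|.
have ps : sublinear p.
  split=> [x z|t x t0]; first exact: ler_normD.
  by rewrite /p normrZ ger0_norm.
pose G : set (Y * R) := [set (t *: y, t * `|y|) | t in [set t : R | 0 <= t]].
have Gp u : G u -> u.2 <= p u.1.
  by move=> [t /= t0 <-]/=; rewrite /p normrZ ger0_norm.
have [f [fp fG]] := hahn_banach_cone ps (cone_ray _ _) Gp.
exists f; split=> [x|].
  by rewrite ler_norml fp andbT lerNl -linearN; have := fp (- x); rewrite /p normrN.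
apply/eqP; rewrite eq_le fp/=; apply: (fG (y, `|y|)).
by exists 1; rewrite /= ?scale1r ?mul1r.
Qed.

Section polyhedral_subspace.
Context {R : realType} {Y : normedModType R} {E : set Y}.
Hypothesis EZ : forall (t : R) x, E x -> E (t *: x).

(** The set where [|f| <= 1] is convex, so it contains the unit ball of [E] as soon as it contains
    the points spanning it; the rest is scaling. *)
Lemma scalar_le_norm (s : seq Y) (f : {scalar Y}) :
  E `&` unit_ball Y = convex_hull [set` s] ->
  (forall a, a \in s -> `|f a| <= 1) -> forall y, E y -> `|f y| <= `|y|.
Proof.
move=> Es fs y Ey; have [->|y0] := eqVneq y 0; first by rewrite linear0 !normr0.
have hull : E `&` unit_ball Y `<=` [set x | `|f x| <= 1].
  rewrite Es; apply: convex_hull_sub => // t x z t0 t1 /= fx fz.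
  rewrite linearD !linearZ/=.
  apply: le_trans (ler_normD _ _) _; rewrite !normrM (ger0_norm t0).
  rewrite (@ger0_norm _ (1 - t)) ?subr_ge0//.
  have : t * `|f x| <= t by rewrite ler_piMr.
  have : (1 - t) * `|f z| <= 1 - t by rewrite ler_piMr// subr_ge0.
  lra.
have : `|f (`|y|^-1 *: y)| <= 1.
  by apply: hull; split; [exact: EZ|rewrite /unit_ball/= normr_normalize].
by rewrite linearZ/= normrM normfV normr_id ler_pdivrMl ?normr_gt0// mulr1.
Qed.

(** A finite invariant that, for functionals bounded by 1 on [s], determines the vectors of [E] they
    norm. *)
Definition activity (s : seq Y) (f : Y -> R) :
    {ffun 'I_(size s) -> bool * bool} :=
  [ffun i : 'I_(size s) => (f s`_i == 1, f s`_i == -1)].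

(* If [f' y < `|y|], then [f + t (f - f')] stays in the dual ball for small [t]
   since it agrees with [f] where [f] is active, but it exceeds the norm at [y]. *)
Lemma norming_activity (s : seq Y) (f f' : {scalar Y}) (y : Y) :
  E `&` unit_ball Y = convex_hull [set` s] ->
  (forall a, a \in s -> `|f a| <= 1) -> (forall a, a \in s -> `|f' a| <= 1) ->
  activity s f = activity s f' -> E y -> f y = `|y| -> f' y = `|y|.
Proof.
move=> Es fs f's ff' Ey fy; apply/eqP; rewrite eq_le.
rewrite (le_trans (ler_norm _) (scalar_le_norm Es f's Ey))/= leNgt; apply/negP => f'y.
have [t [t0 ts]] : exists t : R, 0 < t /\
    forall i : 'I_(size s), `|f s`_i + t * (f s`_i - f' s`_i)| <= 1.
  have near_i (i : 'I_(size s)) :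
      \forall t \near (0 : R)^'+, `|f s`_i + t * (f s`_i - f' s`_i)| <= 1.
    have := congr1 (fun h : {ffun _ -> _} => h i) ff'; rewrite /= !ffunE => -[act1 actN1].
    have si : s`_i \in s by rewrite mem_nth.
    have [f1|f1] := eqVneq (f s`_i) 1.
      move: act1; rewrite f1 eqxx => /esym/eqP ->.
      by apply: nearW => t; rewrite subrr mulr0 addr0 normr1.
    have [fN1|fN1] := eqVneq (f s`_i) (-1).
      move: actN1; rewrite fN1 eqxx => /esym/eqP ->.
      by apply: nearW => t; rewrite subrr mulr0 addr0 normrN normr1.
    (* At a point where [f] is not active, [|f - f'| <= 2] makes half the slack a safe bound for
       [t]. *)
    have slack : 0 < (1 - `|f s`_i|) / 2.
      rewrite divr_gt0// subr_gt0 lt_neqAle fs// andbT.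
      by rewrite eqr_norml (negbTE f1) (negbTE fN1).
    near=> t.
    have t0 : 0 <= t by near: t; exact: nbhs_right_ge.
    have tle : t <= (1 - `|f s`_i|) / 2 by near: t; exact: nbhs_right_le.
    apply: le_trans (ler_normD _ _) _; rewrite normrM (ger0_norm t0).
    have : t * `|f s`_i - f' s`_i| <= t * 2.
      rewrite ler_wpM2l//; apply: le_trans (ler_normB _ _) _.
      by have := fs _ si; have := f's _ si; lra.
    lra.
  have [t [t0 ts]] := filter_ex (filterI (nbhs_right_gt 0) (filter_forall _ near_i)).
  by exists t.
have gP : scalar (fun x => f x + t * (f x - f' x)).
  by move=> a x z; rewrite (linearP f) (linearP f')/=; ring.
pose g : {scalar Y} := HB.pack (fun x => f x + t * (f x - f' x))
  (GRing.isLinear.Build R Y R *%R (fun x => f x + t * (f x - f' x)) gP).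
have gs a : a \in s -> `|g a| <= 1.
  by move=> sa; have := ts (Ordinal (etrans (index_mem a s) sa)); rewrite /= nth_index.
have := le_trans (ler_norm _) (scalar_le_norm Es gs Ey).
rewrite /g/= fy; apply/negP; rewrite -ltNge ltrDl mulr_gt0// subr_gt0//.
Unshelve. all: by end_near. Qed.

(** One functional per activity pattern is enough, since functionals with the same pattern norm the
    same vectors of [E]. *)
Lemma polyhedron_norming : polyhedron (E `&` unit_ball Y) ->
  exists (I : finType) (f : I -> {scalar Y}),
    (forall i y, E y -> `|f i y| <= `|y|) /\
    (forall y, E y -> exists i, f i y = `|y|).
Proof.
move=> [_ /finite_seqP[s ->] Es].
have s1 a : a \in s -> `|a| <= 1.
  move=> sa; have : convex_hull [set` s] a by exact: sub_gen_smallest.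
  by rewrite -Es => -[].
pose D (f : {scalar Y}) := forall a, a \in s -> `|f a| <= 1.
have [f fP] : {f : {ffun 'I_(size s) -> bool * bool} -> {scalar Y} & forall A,
    D (f A) /\ forall g, D g -> activity s g = A -> activity s (f A) = A}.
  apply: (@choice _ _ (fun A (h : {scalar Y}) => D h /\ forall g : {scalar Y},
    D g -> activity s g = A -> activity s h = A)) => A.
  have [[g [Dg gA]]|noA] :=
    pselect (exists g : {scalar Y}, D g /\ activity s g = A).
    by exists g.
  (* A pattern that no functional in [D] realises receives an arbitrary functional of norm at most
     1. *)
  have [h [h1 _]] := norming_scalar (0 : Y).
  exists h; split=> [a sa|g Dg gA]; first exact: le_trans (h1 a) (s1 a sa).
  by exfalso; apply: noA; exists g.
exists _, f; split=> [i y|y Ey].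
  by apply: scalar_le_norm Es _ _; case: (fP i).
have [g [g1 gy]] := norming_scalar y.
have Dg : D g by move=> a sa; exact: le_trans (g1 a) (s1 a sa).
exists (activity s g); have [Df fact] := fP (activity s g).
exact: norming_activity Es Dg Df (esym (fact g Dg erefl)) Ey gy.
Qed.

(* Lindenstrauss' property beta. In a minimal norming family each [f i] is the only
   one norming some vector, which is rescaled to [u i]. *)
Lemma polyhedron_property_beta : polyhedron (E `&` unit_ball Y) ->
  exists (I : finType) (f : I -> {scalar Y}) (A : {set I}) (u : I -> Y) (rho : R),
  [/\ forall i y, E y -> `|f i y| <= `|y|,
      forall y, E y -> y != 0 -> exists2 i, i \in A & `|f i y| = `|y|,
      forall i, i \in A -> [/\ E (u i), `|u i| = 1 & f i (u i) = 1],
      0 <= rho < 1 &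
      forall i j, i \in A -> j \in A -> j != i -> `|f j (u i)| <= rho].
Proof.
move=> /polyhedron_norming[I [f [f_le f_norming]]].
pose norming (A : {set I}) :=
  `[< forall y, E y -> y != 0 -> exists2 i, i \in A & `|f i y| = `|y| >].
have [A /minsetP[/asboolP AN Amin]] : {A | minset norming A}.
  apply: ex_minset; exists (finset.setTfor I); apply/asboolP => y Ey y0.
  by have [i fiy] := f_norming y Ey; exists i; rewrite ?inE// fiy normr_id.
have /choice[u uP] i : exists v, i \in A -> [/\ E v, `|v| = 1, f i v = 1 &
    forall j, j \in A -> j != i -> `|f j v| < 1].
  have [iA|] := boolP (i \in A); last by exists 0.
  have : ~ norming (A :\ i).
    move=> /Amin/(_ (subD1set _ _)) AE.
    by move: iA; rewrite -AE !inE eqxx.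
  move=> /negP/asboolPn/existsNP[y /not_implyP[Ey /not_implyP[y0 nex]]].
  have flt j : j \in A -> j != i -> `|f j y| < `|y|.
    move=> jA ji; rewrite lt_neqAle f_le// andbT; apply/eqP => fy.
    by apply: nex; exists j; rewrite // !inE ji.
  have fiy : `|f i y| = `|y|.
    have [j jA fjy] := AN y Ey y0; have [<-//|ji] := eqVneq j i.
    by have := flt j jA ji; rewrite fjy ltxx.
  have fi0 : f i y != 0 by rewrite -normr_eq0 fiy normr_eq0.
  exists ((f i y)^-1 *: y) => _; split=> [| | |j jA ji].
  - exact: EZ.
  - by rewrite normrZ normfV fiy mulVf// normr_eq0.
  - by rewrite linearZ/= mulVf.
  - by rewrite linearZ/= normrM normfV fiy ltr_pdivrMl ?normr_gt0// mulr1 flt.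
(* The value 0 off the relevant pairs keeps every entry in [[0, 1)], so the finite maximum is a
   valid [rho] even if [A] has at most one element. *)
pose c (ij : I * I) := if [&& ij.1 \in A, ij.2 \in A & ij.2 != ij.1]
  then `|f ij.2 (u ij.1)| else 0.
exists I, f, A, u, (\big[Num.max/0]_ij c ij); split=> //.
- by move=> i /uP[].
- rewrite bigmax_ge_id/=; apply: bigmax_lt => // -[i j] _; rewrite /c/=.
  by case: ifPn => // /and3P[/uP[_ _ _ +] jA ji]; exact.
- move=> i j iA jA ji; apply: le_trans (le_bigmax _ c (i, j)).
  by rewrite /c/= iA jA ji.
Qed.

(** The image of the unit ball lies in a multiple of the unit ball of [E], and the latter in a
    compact set containing the points that span it. *)
Lemma bounded_linear_compact (X : normedModType R) (T : {linear X -> Y}) (M : R) :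
  polyhedron (E `&` unit_ball Y) -> (forall x, E (T x)) ->
  (forall x, `|x| <= 1 -> `|T x| <= M) -> compact_operators X Y T.
Proof.
move=> [_ /finite_seqP[s ->] Es] TE TM.
have [K [Kc sK K0 Kconv]] := compact_convex_superset s.
have EK : E `&` unit_ball Y `<=` K by rewrite Es; exact: convex_hull_sub.
pose N := `|M| + 1; have N0 : 0 < N by rewrite ltr_wpDl.
apply: (@precompact_subset _ _ [set N *: y | y in K]); last first.
  apply: compact_precompact; first exact: norm_hausdorff.
  apply: continuous_compact => //; apply: continuous_subspaceT => y.
  by apply: cvgZl_tmp; exact: cvg_id.
move=> _ [x x1 <-]; exists (N^-1 *: T x); last by rewrite scalerA divff ?scale1r// gt_eqF.
apply: EK; split; first exact: EZ.
rewrite /unit_ball/= normrZ ger0_norm ?invr_ge0 ?(ltW N0)// ler_pdivrMl// mulr1.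
by apply: le_trans (TM _ x1) _; rewrite /N (le_trans (ler_norm M))// lerDl.
Qed.

End polyhedral_subspace.

(** * Linear spans and operator norms *)

Section lin_span_theory.
Context {R : realType} {V : lmodType R} {n : nat} (e : 'I_n -> V).

Lemma lin_spanD x y : lin_span e x -> lin_span e y -> lin_span e (x + y).
Proof.
move=> [a _ <-] [b _ <-]; exists (fun i => a i + b i) => //.
by rewrite -big_split; apply: eq_bigr => i _; rewrite scalerDl.
Qed.

Lemma lin_spanZ t x : lin_span e x -> lin_span e (t *: x).
Proof.
move=> [a _ <-]; exists (fun i => t * a i) => //.
by rewrite scaler_sumr; apply: eq_bigr => i _; rewrite scalerA.
Qed.

End lin_span_theory.

Section operator_norm.
Context {R : realType} {X Y : normedModType R}.

Lemma op_norm_le (T : X -> Y) (M : R) :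
  (forall x, `|x| <= 1 -> `|T x| <= M) -> op_norm T <= M.
Proof.
move=> TM; apply: ge_sup; first by exists `|T 0|, 0; rewrite /unit_ball/= ?normr0.
by move=> _ [x x1 <-]; exact: TM.
Qed.

Lemma le_op_norm (T : X -> Y) (M : R) (x : X) :
  (forall x, `|x| <= 1 -> `|T x| <= M) -> `|x| <= 1 -> `|T x| <= op_norm T.
Proof.
move=> TM x1; apply: ub_le_sup; last by exists x.
by exists M => _ [z z1 <-]; exact: TM.
Qed.

Lemma le_op_norm_linear (T : {linear X -> Y}) (M : R) (x : X) :
  (forall x, `|x| <= 1 -> `|T x| <= M) -> `|T x| <= op_norm T * `|x|.
Proof.
move=> TM; have [->|x0] := eqVneq x 0; first by rewrite linear0 !normr0 mulr0.
have := le_op_norm TM (_ : `| `|x|^-1 *: x| <= 1); rewrite normr_normalize//.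
move=> /(_ (lexx _)); rewrite linearZ/= normrZ normfV normr_id.
by rewrite ler_pdivrMl ?normr_gt0// mulrC.
Qed.

Lemma op_norm_near (T : X -> Y) (M d : R) : 0 < d ->
  (forall x, `|x| <= 1 -> `|T x| <= M) ->
  exists2 x, `|x| <= 1 & op_norm T - d < `|T x|.
Proof.
move=> d0 TM.
have supT : has_sup [set `|T x| | x in unit_ball X].
  split; first by exists `|T 0|, 0; rewrite /unit_ball/= ?normr0.
  by exists M => _ [z z1 <-]; exact: TM.
by have [_ [x x1 <-]] := sup_adherent d0 supT; exists x.
Qed.

Lemma bounded_operatorP (T : {linear X -> Y}) (M : R) :
  (forall x, `|x| <= 1 -> `|T x| <= M) -> bounded_operator T.
Proof.
move=> TM; exists M; split; first exact: num_real.
by move=> N /ltW MN x x1; exact: le_trans (TM x x1) MN.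
Qed.

Lemma compact_operator_bounded (T : {linear X -> Y}) : compact_operators X Y T ->
  exists M, forall x, `|x| <= 1 -> `|T x| <= M.
Proof.
rewrite /compact_operators/= precompactE => /compact_bounded[M [_ TM]].
(* Boundedness provides a bound at every real above [M], not at [M] itself. *)
exists (M + 1) => x x1; apply: (TM (M + 1)); first by rewrite ltrDl.
by apply: subset_closure; exists x.
Qed.

End operator_norm.

(** * Norm-attaining approximation of operators *)

(* Lindenstrauss' perturbation: [S] is modified in the direction [u i] only, so
   that [f i] composed with it becomes [(1 + eta) g] with [g] norm attaining, while
   property beta keeps the other functionals below the norm of [(1 + eta) g]. *)
Theorem norm_attaining_dense_into_polyhedral (R : realType) (X : completeNormedModType R)
    (Y : normedModType R) (E : set Y) (S : {linear X -> Y}) (M eps : R) :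
  (forall x y, E x -> E y -> E (x + y)) ->
  (forall (t : R) x, E x -> E (t *: x)) -> polyhedron (E `&` unit_ball Y) ->
  (exists x : X, x != 0) -> (forall x, E (S x)) ->
  (forall x, `|x| <= 1 -> `|S x| <= M) -> 0 < eps ->
  exists S' : {linear X -> Y}, [/\ compact_operators X Y S', norm_attaining X Y S' &
    forall x, `|x| <= 1 -> `|S x - S' x| <= eps].
Proof.
move=> ED EZ Epoly [z z0] SE SM eps0.
have S_le x : `|x| <= 1 -> `|S x| <= op_norm S by move=> x1; exact: le_op_norm SM x1.
have S_leZ x : `|S x| <= op_norm S * `|x| by exact: le_op_norm_linear SM.
set a := op_norm S in S_le S_leZ.
have a_ge0 : 0 <= a by apply: le_trans (normr_ge0 (S 0)) (S_le 0 _); rewrite normr0.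
(* If [S] vanishes, its norm is attained at any unit vector, which exists since [X] is nonzero. *)
have [a0|a_neq0] := eqVneq a 0.
  have S0 x : `|x| <= 1 -> `|S x| <= 0 by rewrite -a0; exact: S_le.
  exists S; split.
  - exact: bounded_linear_compact Epoly SE S0.
  - split; first exact: bounded_operatorP S0.
    exists (`|z|^-1 *: z); rewrite normr_normalize//; split=> //.
    rewrite -/a a0; apply/eqP; rewrite eq_le normr_ge0/=.
    by apply: S0; rewrite normr_normalize.
  - by move=> x _; rewrite subrr normr0 ltW.
have a_gt0 : 0 < a by rewrite lt_def a_neq0.
have [I [f [A [u [rho [f_le f_norming uP /andP[rho0 rho1] f_rho]]]]]] :=
  polyhedron_property_beta EZ Epoly.
(* The perturbation will be at most [eta * a + 2 * d]; with [6 * d <= eta * a] this stays below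
   [2 * (eta * a) <= eps]. *)
pose eta := Num.min 1 (eps / (2 * a)).
have eta0 : 0 < eta by rewrite lt_min ltr01 divr_gt0// mulr_gt0.
have eta1 : eta <= 1 by rewrite ge_min lexx.
have eta_eps : 2 * (eta * a) <= eps.
  have : eta <= eps / (2 * a) by rewrite ge_min lexx orbT.
  by rewrite ler_pdivlMr ?mulr_gt0// mulrCA.
(* The largest [d] for which [a + rho * (eta * a) + 2 * d], a bound for the functionals other than
   [f i], stays below [(1 + eta) * a - 4 * d], a lower bound for the new norm. *)
pose d := (1 - rho) * eta * a / 6.
have d0 : 0 < d by rewrite divr_gt0// !mulr_gt0// subr_gt0.
have dE : 6 * d = (1 - rho) * (eta * a) by rewrite /d; field.
have eta_a : 0 < eta * a by rewrite mulr_gt0.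
have eta_a_le : eta * a <= a by rewrite ler_piMl.
have rho_eta : 0 <= rho * (eta * a) by rewrite mulr_ge0// ltW.
have d_le : 6 * d <= eta * a by rewrite dE; lra.
have [x1 x1_le Sx1] := op_norm_near d0 SM; rewrite -/a in Sx1.
have Sx1_neq0 : S x1 != 0 by rewrite -normr_gt0; lra.
have [i iA fiS] := f_norming _ (SE x1) Sx1_neq0.
have [Eu u_norm fiu] := uP i iA.
have phiP : scalar (fun x => f i (S x)) by move=> t x y; rewrite !linearP.
pose phi : {scalar X} := HB.pack (fun x => f i (S x))
  (GRing.isLinear.Build R X R *%R (fun x => f i (S x)) phiP).
have phi_le x : `|phi x| <= a * `|x|.
  by apply: le_trans (f_le i _ (SE x)) _; exact: S_leZ.
have [g [x0 [x0_le gmax g_phi]]] := bishop_phelps d0 phi_le.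
have g_abs x : `|x| <= 1 -> `|g x| <= g x0.
  move=> xle; rewrite ler_norml gmax// andbT lerNl -linearN.
  by apply: gmax; rewrite normrN.
have g_phi1 x : `|x| <= 1 -> `|phi x - g x| <= d.
  by move=> xle; apply: le_trans (g_phi x) _; rewrite ler_piMr// ltW.
have g_lower : a - 2 * d < g x0.
  have := g_abs _ x1_le; have := g_phi1 _ x1_le; have := lerB_dist (phi x1) (g x1).
  by rewrite {1}/phi/= fiS; lra.
have g_upper : g x0 <= a + d.
  have := g_phi1 _ x0_le; rewrite ler_norml => /andP[+ _].
  have := le_trans (ler_norm _) (phi_le x0).
  have : a * `|x0| <= a by rewrite ler_piMr.
  lra.
have g_gt0 : 0 < g x0 by lra.
(* The maximum of a functional positive at [x0] lies on the sphere: normalising [x0] would otherwise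
   increase it. *)
have x0_norm : `|x0| = 1.
  apply/eqP; rewrite eq_le x0_le/=.
  have x0_neq0 : x0 != 0 by apply: contraTneq g_gt0 => ->; rewrite linear0 ltxx.
  have := gmax (`|x0|^-1 *: x0); rewrite normr_normalize// => /(_ (lexx _)).
  by rewrite linearZ/= ler_pdivrMl ?normr_gt0// ler_pMl.
pose k x := (1 + eta) * g x - phi x.
have S'P : linear (fun x => S x + k x *: u i).
  move=> t x y; rewrite /k linearP (linearP g) (linearP phi)/=.
  rewrite scalerDr addrACA scalerA -scalerDl; congr (_ + _ *: _); ring.
pose S' : {linear X -> Y} := HB.pack (fun x => S x + k x *: u i)
  (GRing.isLinear.Build R X Y *:%R (fun x => S x + k x *: u i) S'P).
have S'E x : E (S' x) by apply: ED => //; exact: EZ.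
have fiS' x : f i (S' x) = (1 + eta) * g x.
  by rewrite /S'/= linearD linearZ/= fiu mulr1 /k /phi/= [LHS]addrC subrK.
have k_le x : `|x| <= 1 -> `|k x| <= d + eta * g x0.
  move=> xle; rewrite /k (_ : _ - _ = eta * g x - (phi x - g x)); last by ring.
  apply: le_trans (ler_normB _ _) _; rewrite addrC normrM (gtr0_norm eta0).
  by apply: lerD; [exact: g_phi1|rewrite ler_pM2l// g_abs].
have eta_g : eta * g x0 <= eta * a + d.
  have : eta * g x0 <= eta * (a + d) by rewrite ler_pM2l.
  have : eta * d <= d by rewrite ler_piMl// ltW.
  by rewrite mulrDr; lra.
have eta_g_lower : eta * a - 2 * d <= eta * g x0.
  have : eta * (a - 2 * d) <= eta * g x0 by rewrite ler_pM2l// ltW.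
  have : eta * d <= d by rewrite ler_piMl// ltW.
  by rewrite mulrBr; lra.
have S'_le x : `|x| <= 1 -> `|S' x| <= (1 + eta) * g x0.
  move=> xle; have [->|S'x0] := eqVneq (S' x) 0.
    by rewrite normr0 mulr_ge0 ?ltW// addr_gt0.
  have [j jA <-] := f_norming _ (S'E x) S'x0.
  have [->|ji] := eqVneq j i.
    have eta1_gt0 : 0 < 1 + eta by rewrite addr_gt0.
    by rewrite fiS' normrM gtr0_norm// ler_pM2l// g_abs.
  (* Property beta damps the perturbation by [rho]: here the bound is
     [a + rho * (eta * a + 2 * d)]. *)
  rewrite /S'/= linearD linearZ/=.
  apply: le_trans (ler_normD _ _) _; rewrite normrM.
  have fjS := le_trans (f_le j _ (SE x)) (S_le x xle).
  have : `|k x| * `|f j (u i)| <= (d + eta * g x0) * rho.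
    by apply: ler_pM => //; [exact: k_le|exact: f_rho].
  have : rho * d <= d by rewrite ler_piMl// ltW.
  have : (d + eta * g x0) * rho <= (d + (eta * a + d)) * rho.
    by rewrite ler_wpM2r// lerD2l.
  rewrite (_ : (d + (eta * a + d)) * rho = 2 * (rho * d) + rho * (eta * a)); last by ring.
  by move: dE; rewrite (mulrDl 1 eta) mulrBl !mul1r; lra.
have S'x0 : `|S' x0| = (1 + eta) * g x0.
  apply/eqP; rewrite eq_le S'_le//=; apply: le_trans (f_le i _ (S'E x0)).
  by rewrite fiS' ler_norm.
exists S'; split.
- exact: bounded_linear_compact Epoly S'E S'_le.
- split; first exact: bounded_operatorP S'_le.
  exists x0; split=> //; apply/eqP; rewrite eq_le (le_op_norm S'_le x0_le) andbT.
  by rewrite S'x0; exact: op_norm_le.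
- move=> x xle; rewrite /S'/= opprD addNKr normrN normrZ u_norm mulr1.
  by apply: le_trans (k_le x xle) _; lra.
Qed.

Theorem corollary4p5 (R : realType) (Y : completeNormedModType R) :
  polyhedral Y -> approximation_property Y -> property_Bk Y.
Proof.
move=> Ypoly Yap X X0 T Tc eps eps0.
have [M TM] := compact_operator_bounded Tc.
(* Two errors of [eps / 3] leave room for the strict inequality, as [op_norm_le] is not strict. *)
have eps3 : 0 < eps / 3 by rewrite divr_gt0.
move: (Tc); rewrite /compact_operators/= precompactE => /Yap/(_ _ eps3)[F [_ Ffin Fapp]].
have FT x : `|x| <= 1 -> `|T x - F (T x)| <= eps / 3.
  by move=> x1; apply/ltW/Fapp/subset_closure; exists x.
have [n [e Fe]] := Ffin.
have Fpoly := Ypoly _ Ffin; rewrite Fe in Fpoly.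
pose S : {linear X -> Y} := F \o T.
have SE x : lin_span e (S x) by rewrite -Fe; exists (T x).
have SM x : `|x| <= 1 -> `|S x| <= M + eps / 3.
  move=> x1; rewrite -(subKr (T x) (S x)); apply: le_trans (ler_normB _ _) _.
  by apply: lerD; [exact: TM|exact: FT].
have [S' [S'c S'na SS']] := norm_attaining_dense_into_polyhedral
  (@lin_spanD _ _ _ e) (@lin_spanZ _ _ _ e) Fpoly X0 SE SM eps3.
exists S'; split=> //; apply: (@le_lt_trans _ _ (eps / 3 + eps / 3)); last by lra.
apply: op_norm_le => x x1 /=.
apply: le_trans (ler_distD (S x) _ _) _; apply: lerD; [exact: FT|exact: SS'].
Qed.
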